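(* Let $\mathbb Z_4=\mathbb Z/4\mathbb Z$ and $$S=\left\{\begin{pmatrix}a&b\\c&d\end{pmatrix}\in \operatorname{M}_2(\mathbb Z_4): b\in 2\mathbb Z_4\right\},$$ and let $$\mathcal R_4=\left\{\begin{pmatrix}C&D\\0&C\end{pmatrix}: C\in \operatorname{T}_2(\mathbb F_2),\ D\in \operatorname{M}_2(\mathbb F_2)\right\}.$$ Then no quotient of $S$ is isomorphic to $\mathcal R_4$; that is, there is no two-sided ideal $I$ of $S$ such that $S/I\cong\mathcal R_4$ as rings.
   Context: All rings are associative with identity. $\operatorname{M}_2(K)$ is the ring of $2\times2$ matrices over $K$, and $\operatorname{T}_2(\mathbb F_2)$ is the ring of upper triangular $2\times2$ matrices over the field $\mathbb F_2$ with two elements. $S$ is a subring of $\operatorname{M}_2(\mathbb Z_4)$; $\mathcal R_4$ is a ring of $4\times4$ matrices over $\mathbb F_2$ written in $2\times2$ blocks (a subring of $\operatorname{M}_4(\mathbb F_2)$). *)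

(* Defs.v *)
From HB Require Import structures.
From mathcomp Require Import all_boot all_order all_algebra ring_quotient.

Set Implicit Arguments.
Unset Strict Implicit.
Unset Printing Implicit Defensive.

Import GRing.Theory.
Local Open Scope ring_scope.
Local Open Scope quotient_scope.

(* The library's [idealr] only covers proper left-multiplication-stable subsets,
   and its ring structure on quotients is restricted to commutative rings.
   Below, the unit ideal is allowed, so that quotients live in [pzRingType].
   Ideals are decidable subsets; on a finite carrier this is no restriction.   *)
HB.mixin Record isTwoSidedIdeal (R : pzRingType) (I : R -> bool) := {
  ideal_mulLR : forall a : R, {in I, forall x, a * x \in I /\ x * a \in I}
}.

#[short(type="twoSidedIdeal")]
HB.structure Definition TwoSidedIdeal (R : pzRingType) :=
  {I of GRing.ZmodClosed R I & isTwoSidedIdeal R I}.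

Definition ringQuot (R : pzRingType) (I : twoSidedIdeal R) : Type :=
  Quotient.quot I.

Section RingQuot.
Variables (R : pzRingType) (I : twoSidedIdeal R).
Local Notation Q := (ringQuot I).

HB.instance Definition _ :=
  ZmodQuotient.copy Q (Quotient.quot I).

Definition ringQuot_one : Q := lift_cst Q 1.
Definition ringQuot_mul := lift_op2 Q *%R.

Lemma pi_ringQuot_mul : {morph \pi_Q : x y / x * y >-> ringQuot_mul x y}.
Proof.
move=> x y; unlock ringQuot_mul; apply/eqP.
rewrite -(Quotient.idealrBE I).
set x' := repr _; set y' := repr _.
have Ex : x - x' \in I.
  by rewrite Quotient.idealrBE /x' reprK.
have Ey : y - y' \in I.
  by rewrite Quotient.idealrBE /y' reprK.
have -> : x * y - x' * y' = (x - x') * y + x' * (y - y').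
  by rewrite mulrBl mulrBr addrA subrK.
by rewrite rpredD // ?(ideal_mulLR y _ Ex).2 ?(ideal_mulLR x' _ Ey).1.
Qed.

Lemma pi_ringQuot_one : \pi_Q 1 = ringQuot_one.
Proof. by rewrite /ringQuot_one; unlock. Qed.

Lemma ringQuot_mulA : associative ringQuot_mul.
Proof.
move=> x y z; rewrite -[x]reprK -[y]reprK -[z]reprK.
by rewrite -!pi_ringQuot_mul mulrA.
Qed.

Lemma ringQuot_mul1l : left_id ringQuot_one ringQuot_mul.
Proof.
by move=> x; rewrite -[x]reprK -pi_ringQuot_one -pi_ringQuot_mul mul1r.
Qed.

Lemma ringQuot_mul1r : right_id ringQuot_one ringQuot_mul.
Proof.
by move=> x; rewrite -[x]reprK -pi_ringQuot_one -pi_ringQuot_mul mulr1.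
Qed.

Lemma ringQuot_mulDl : left_distributive ringQuot_mul +%R.
Proof.
move=> x y z; rewrite -[x]reprK -[y]reprK -[z]reprK.
by rewrite -pi_addr -!pi_ringQuot_mul -pi_addr mulrDl.
Qed.

Lemma ringQuot_mulDr : right_distributive ringQuot_mul +%R.
Proof.
move=> x y z; rewrite -[x]reprK -[y]reprK -[z]reprK.
by rewrite -pi_addr -!pi_ringQuot_mul -pi_addr mulrDr.
Qed.

HB.instance Definition _ := GRing.Zmodule_isPzRing.Build Q
  ringQuot_mulA ringQuot_mul1l ringQuot_mul1r ringQuot_mulDl ringQuot_mulDr.

Definition ringQuot_pi : R -> Q := \pi_Q.

Lemma ringQuot_pi_zmod_morphism : zmod_morphism ringQuot_pi.
Proof. exact: (@pi_is_zmod_morphism _ _ _ Q). Qed.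

Lemma ringQuot_pi_monoid_morphism : monoid_morphism ringQuot_pi.
Proof. by split; [exact: pi_ringQuot_one | exact: pi_ringQuot_mul]. Qed.

HB.instance Definition _ :=
  GRing.isZmodMorphism.Build R Q ringQuot_pi ringQuot_pi_zmod_morphism.
HB.instance Definition _ :=
  GRing.isMonoidMorphism.Build R Q ringQuot_pi ringQuot_pi_monoid_morphism.

Lemma ringQuot_pi_eq0 (x : R) : (ringQuot_pi x == 0) = (x \in I).
Proof.
by rewrite -(rmorph0 ringQuot_pi) -[in RHS](subr0 x) (Quotient.idealrBE I).
Qed.

End RingQuot.

Definition ring_isomorphic (A B : pzRingType) : Prop :=
  exists f : {rmorphism A -> B}, bijective f.

(* Indices start at 0: entry [A 0 1] is the upper right one. *)
Definition S_pred : {pred 'M['Z_4]_2} :=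
  fun A => [exists t : 'Z_4, A 0 1 == 2%:R * t].

Lemma S_subring : subring_closed S_pred.
Proof.
split=> [|A B /existsP[s /eqP hs] /existsP[t /eqP ht]
         |A B /existsP[s /eqP hs] /existsP[t /eqP ht]]; apply/existsP.
- by exists 0; rewrite mxE mulr0.
- by exists (s - t); rewrite !mxE hs ht mulrBr.
- exists (A 0 0 * t + s * B 1 1).
  have E : lift ord0 ord0 = 1 :> 'I_2 by apply: val_inj.
  by rewrite mxE !big_ord_recl big_ord0 addr0 /= E ht hs mulrCA -mulrA mulrDr.
Qed.

HB.instance Definition _ :=
  GRing.isSubringClosed.Build 'M['Z_4]_2 S_pred S_subring.

Record ringS : Type := MkS { S_val :> 'M['Z_4]_2; S_valP : S_val \in S_pred }.

HB.instance Definition _ := [isSub for S_val].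
HB.instance Definition _ := [Finite of ringS by <:].
HB.instance Definition _ :=
  GRing.SubChoice_isSubPzRing.Build 'M['Z_4]_2 S_pred ringS S_subring.

(* [is_trig_mx] is the library's predicate for lower triangular matrices. *)
Definition T2 : {pred 'M['F_2]_2} := fun C => is_trig_mx C^T.

Definition R4_pred : {pred 'M['F_2]_(2 + 2)} :=
  fun A => [exists C : 'M['F_2]_2, exists D : 'M['F_2]_2,
    (C \in T2) && (A == block_mx C D 0 C)].

Lemma R4_subring : subring_closed R4_pred.
Proof.
split=> [|A B|A B].
- apply/existsP; exists 1; apply/existsP; exists 0.
  rewrite -(@scalar_mx_block _ 2 2 1) eqxx andbT /T2 unfold_in.
  by rewrite (trmx1 _ 2) scalar_mx_is_trig.
- case/existsP=> C /existsP[D /andP[TC /eqP->]].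
  case/existsP=> C' /existsP[D' /andP[TC' /eqP->]].
  apply/existsP; exists (C - C'); apply/existsP; exists (D - D').
  rewrite opp_block_mx add_block_mx oppr0 addr0 eqxx andbT.
  apply/is_trig_mxP=> i j ij.
  have /is_trig_mxP/(_ i j ij) := TC; have /is_trig_mxP/(_ i j ij) := TC'.
  by rewrite !mxE => -> ->; rewrite subr0.
- case/existsP=> C /existsP[D /andP[TC /eqP->]].
  case/existsP=> C' /existsP[D' /andP[TC' /eqP->]].
  apply/existsP; exists (C * C'); apply/existsP; exists (C *m D' + D *m C').
  rewrite [_ * _ in X in _ && X]mulmx_block !mul0mx !mulmx0 !addr0 add0r.
  rewrite eqxx andbT.
  apply/is_trig_mxP=> i j ij; rewrite !mxE big1 // => k _.
  have [ki|ik] := ltnP i k.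
    by have /is_trig_mxP/(_ _ _ ki) := TC'; rewrite !mxE => ->; rewrite mulr0.
  have kj : (k < j)%N by exact: leq_ltn_trans ij.
  by have /is_trig_mxP/(_ _ _ kj) := TC; rewrite !mxE => ->; rewrite mul0r.
Qed.

HB.instance Definition _ :=
  GRing.isSubringClosed.Build 'M['F_2]_(2 + 2) R4_pred R4_subring.

Record ringR4 : Type :=
  MkR4 { R4_val :> 'M['F_2]_(2 + 2); R4_valP : R4_val \in R4_pred }.

HB.instance Definition _ := [isSub for R4_val].
HB.instance Definition _ := [Finite of ringR4 by <:].
HB.instance Definition _ :=
  GRing.SubChoice_isSubPzRing.Build 'M['F_2]_(2 + 2) R4_pred ringR4 R4_subring.

(* Main.v *)
(* In [S] every product of two commutators lies in [2S], whereas [2 = 0] in [R4]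
   and [R4] has commutators with a nonzero product.  A surjective ring morphism
   from [S] to [R4] would carry the first property over to [R4]. *)

Require Import Defs.
From mathcomp Require Import all_boot all_order all_algebra.
From mathcomp Require Import ring.

Set Implicit Arguments.
Unset Strict Implicit.
Unset Printing Implicit Defensive.

Import GRing.Theory.
Local Open Scope ring_scope.

Definition commutator (R : pzRingType) (x y : R) : R := x * y - y * x.

Lemma rmorph_commutator (R T : pzRingType) (f : {rmorphism R -> T}) x y :
  f (commutator x y) = commutator (f x) (f y).
Proof. by rewrite rmorphB !rmorphM. Qed.

(** Four explicit entries reduce each matrix identity below to identities between scalars. *)
Definition mx2 (R : Type) (a b c d : R) : 'M[R]_2 :=
  \matrix_(i, j) if i == 0 then (if j == 0 then a else b)
                 else (if j == 0 then c else d).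

Lemma mx2P (R : Type) (A : 'M[R]_2) : A = mx2 (A 0 0) (A 0 1) (A 1 0) (A 1 1).
Proof.
apply/matrixP=> i j; rewrite mxE.
by case: i j => [[|[|//]] ?] [[|[|//]] ?]; congr (A _ _); apply: val_inj.
Qed.

Lemma mulmx2 (R : pzRingType) (a b c d a' b' c' d' : R) :
  mx2 a b c d *m mx2 a' b' c' d' =
  mx2 (a * a' + b * c') (a * b' + b * d') (c * a' + d * c') (c * b' + d * d').
Proof.
apply/matrixP=> i j; rewrite !mxE !big_ord_recl big_ord0 addr0 !mxE /=.
by case: ifP; case: ifP.
Qed.

Lemma addmx2 (R : pzRingType) (a b c d a' b' c' d' : R) :
  mx2 a b c d + mx2 a' b' c' d' = mx2 (a + a') (b + b') (c + c') (d + d').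
Proof. by apply/matrixP=> i j; rewrite !mxE; case: ifP; case: ifP. Qed.

Lemma oppmx2 (R : pzRingType) (a b c d : R) :
  - mx2 a b c d = mx2 (- a) (- b) (- c) (- d).
Proof. by apply/matrixP=> i j; rewrite !mxE; case: ifP; case: ifP. Qed.

(** Writing the even entry as [2 * b] turns membership in [S] into polynomial data that [ring] can
    handle. *)
Lemma ringS_mx2 (A : ringS) : exists a b c d, S_val A = mx2 a (2 * b) c d.
Proof.
have /existsP[b /eqP A01] := S_valP A.
exists (A 0 0), b, (A 1 0), (A 1 1).
by rewrite {1}[S_val A]mx2P A01.
Qed.

Lemma mx2_in_S a b c d : mx2 a (2 * b) c d \in S_pred.
Proof. by apply/existsP; exists b; rewrite mxE. Qed.

(** Modulo 2 the elements of [S] are lower triangular, so a commutator is strictly lower triangular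
    modulo 2; its trace is 0, hence the opposite diagonal entries. *)
Lemma commutator_ringS (A B : ringS) :
  exists p q r, S_val (commutator A B) = mx2 (2 * p) (2 * q) r (- (2 * p)).
Proof.
have [a [b [c [d EA]]]] := ringS_mx2 A.
have [a' [b' [c' [d' EB]]]] := ringS_mx2 B.
exists (b * c' - b' * c), (a * b' + b * d' - a' * b - b' * d).
exists (c * a' + d * c' - c' * a - d' * c).
rewrite [LHS](rmorph_commutator \val) /commutator /= EA EB.
rewrite -!mulmxE !mulmx2 oppmx2 addmx2.
by congr mx2; ring.
Qed.

(** Two strictly lower triangular 2 by 2 matrices have product 0, so modulo 2 the product of the
    commutators vanishes. It remains to halve it inside [S]. *)
Lemma mul_commutators_ringS (A B C D : ringS) :
  exists T : ringS, commutator A B * commutator C D = T *+ 2.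
Proof.
have [p [q [r E]]] := commutator_ringS A B.
have [p' [q' [r' E']]] := commutator_ringS C D.
(* Half of each entry of the product, once the multiples of 4 are dropped; the upper right entry
   consists only of such multiples. *)
exists (MkS (mx2_in_S (q * r') 0 (r * p' - p * r') (r * q'))).
have four0 : 2 * 2 = 0 :> 'Z_4 by apply: val_inj.
apply: val_inj; rewrite [LHS]rmorphM raddfMn.
rewrite [X in X * _]E [X in _ * X]E' /= -mulmxE mulmx2 [RHS]mulr2n [RHS]addmx2; congr mx2.
(* The equality relies on 4 = 0, not only on the ring axioms, so the factor [2 * 2] is isolated
   first. *)
- transitivity (2 * 2 * (p * p') + 2 * (q * r')); first by ring.
  by rewrite four0; ring.
- transitivity (2 * 2 * (p * q' - q * p')); first by ring.
  by rewrite four0; ring.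
- by ring.
- transitivity (2 * 2 * (p * p') + 2 * (r * q')); first by ring.
  by rewrite four0; ring.
Qed.

Lemma block_in_R4 a b d (D : 'M['F_2]_2) :
  block_mx (mx2 a b 0 d) D 0 (mx2 a b 0 d) \in R4_pred.
Proof.
apply/existsP; exists (mx2 a b 0 d); apply/existsP; exists D.
rewrite eqxx andbT; apply/is_trig_mxP=> i j ij; rewrite !mxE.
by case: i j ij => [[|[|//]] ?] [[|[|//]] ?].
Qed.

Definition blockR4 a b d D : ringR4 := MkR4 (block_in_R4 a b d D).

Lemma ringR4_mulr2n (x : ringR4) : x *+ 2 = 0.
Proof.
apply: val_inj; rewrite raddfMn raddf0 -scaler_nat.
by rewrite (_ : 2%:R = 0 :> 'F_2) ?scale0r //; apply: val_inj.
Qed.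

(** With matrix units, [e] and [n] carry E11 and E12 in both diagonal blocks, and [d] carries E21 in
    the upper right block. The commutators are again [n] and [d], and E12 E21 = E11 survives in the
    upper right block. *)
Lemma mul_commutators_ringR4 :
  let e := blockR4 1 0 0 0 in
  let n := blockR4 0 1 0 0 in
  let d := blockR4 0 0 0 (mx2 0 0 1 0) in
  commutator e n * commutator d e <> 0.
Proof.
move=> e n d /(congr1 val).
rewrite [LHS]rmorphM [X in X * _](rmorph_commutator \val).
rewrite [X in _ * X](rmorph_commutator \val) raddf0 /commutator /=.
(* This is the top left entry of the upper right block, where the product has a 1. *)
move/matrixP/(_ (lshift 2 0) (rshift 2 0)).
rewrite -!mulmxE !mulmx_block !(mul0mx, mulmx0, addr0, add0r).
rewrite !(opp_block_mx, add_block_mx) mulmx_block block_mxEur.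
by rewrite !(mulmx2, oppmx2, addmx2, mul0mx, mulmx0, oppr0, addr0, add0r) !mxE.
Qed.

Theorem corollary5p3 :
  ~ exists I : twoSidedIdeal ringS, ring_isomorphic (ringQuot I) ringR4.
Proof.
case=> I [f [g _ gK]].
have surj y : exists x, f (ringQuot_pi I x) = y.
  (* A preimage of [y] is any representative of the class [g y]. *)
  by exists (repr (g y)); rewrite /ringQuot_pi reprK gK.
apply: mul_commutators_ringR4.
have [A <-] := surj (blockR4 1 0 0 0).
have [B <-] := surj (blockR4 0 1 0 0).
have [D <-] := surj (blockR4 0 0 0 (mx2 0 0 1 0)).
rewrite -!rmorph_commutator -!rmorphM.
have [T ->] := mul_commutators_ringS A B D A.
by rewrite !rmorphMn ringR4_mulr2n.
Qed.
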